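(* Let $\Gamma$ be a simplicial graph and $\mathcal{G}=\{G_u \mid u\in V(\Gamma)\}$ a collection of non-trivial groups indexed by $V(\Gamma)$. If $\Gamma$ is not complete, then $\mathrm{PConjAut}(\Gamma\mathcal{G})$ admits a quotient $Q$ which acts fixed-point freely on a simplicial tree $T$. Moreover, if $\Gamma$ is finite and if the vertex-groups $G_u$ are all finitely generated, then the action $Q\curvearrowright T$ admits a WPD isometry.
   Context: The graph product $\Gamma\mathcal{G}$ is the quotient of the free product $\ast_{u\in V(\Gamma)} G_u$ by the normal closure of all commutators $[g,h]$ with $g\in G_u$, $h\in G_v$, $\{u,v\}\in E(\Gamma)$. The groups $G_u$ are called factors or vertex-groups; they are always assumed non-trivial. An automorphism of $\Gamma\mathcal{G}$ is conjugating if it sends each factor to a conjugate of a factor (possibly different). $\mathrm{ConjAut}(\Gamma\mathcal{G})$ denotes the group of conjugating automorphisms, and $\mathrm{PConjAut}(\Gamma\mathcal{G})$ its subgroup of automorphisms sending each factor to a conjugate of itself. A graph is complete if any two distinct vertices are adjacent. A group acts fixed-point freely on a tree if the action has no global fixed point. If a group $G$ acts on a simplicial tree $T$, an element $g\in G$ is WPD (Weakly Properly Discontinuous) if it is loxodromic and its axis contains two vertices $u$ and $v$ (not necessarily distinct) such that $\mathrm{stab}_G(u)\cap \mathrm{stab}_G(v)$ is finite; the action admits a WPD isometry if some element of the group is WPD. *)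

(* Defs.v *)
From HB Require Import structures.
From mathcomp Require Import all_boot all_order all_algebra.
From mathcomp Require Import generic_quotient.
From mathcomp Require Import all_classical.

Set Implicit Arguments.
Unset Strict Implicit.
Unset Printing Implicit Defensive.

Local Open Scope classical_set_scope.
Local Open Scope quotient_scope.
Local Open Scope group_scope.

(** * Simplicial graphs and trees *)

Record sgraph := SGraph {
  vertex :> choiceType;
  adj : rel vertex;
  adj_sym : symmetric adj;
  adj_irr : irreflexive adj }.

Definition complete_graph (Gam : sgraph) := forall u v : Gam, u != v -> adj u v.

Definition connected_graph (T : sgraph) :=
  forall x y : T, exists2 p : seq T, path (@adj T) x p & last x p = y.

(* [ucycle] alone also holds of the empty cycle and of an edge traversed back
   and forth. *)
Definition acyclic (T : sgraph) :=
  forall c : seq T, ucycle (@adj T) c -> (size c <= 2)%N.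

Definition is_tree (T : sgraph) :=
  [/\ inhabited T, connected_graph T & acyclic T].

(** * Generalities on (possibly infinite) groups *)

Definition nontrivial (G : groupType) := exists g : G, g != 1.

Definition finitely_generated (G : groupType) :=
  exists s : seq G, forall H : {pred G},
    group_closed H -> {subset s <= H} -> forall x : G, x \in H.

Definition normal_closure (G : groupType) (S : set G) : set G :=
  [set x | forall H : {pred G}, group_closed H ->
     (forall h g : G, h \in H -> h ^ g \in H) ->
     {subset S <= H} -> x \in H].

Section NormalClosure.
Variables (G : groupType) (S : set G).
Let N := normal_closure S.

Lemma normal_closure1 : N 1.
Proof. by move=> H []. Qed.

Lemma normal_closureF x y : N x -> N y -> N (x / y).
Proof.
move=> Nx Ny H gH nH sH; have [_ HF] := gH.
by apply: HF; [exact: Nx | exact: Ny].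
Qed.

Lemma normal_closureV x : N x -> N x^-1.
Proof. by move=> /(normal_closureF normal_closure1); rewrite mul1g. Qed.

Lemma normal_closureM x y : N x -> N y -> N (x * y).
Proof. by move=> Nx /normal_closureV/(normal_closureF Nx); rewrite invgK. Qed.

Lemma normal_closureJ (x g : G) : N x -> N (x ^ g).
Proof. by move=> Nx H gH nH sH; apply: (nH); exact: Nx. Qed.

Definition nc_rel : rel G := fun x y => `[< N (x^-1 * y) >].

Lemma nc_relP x y : reflect (N (x^-1 * y)) (nc_rel x y).
Proof. exact: asboolP. Qed.

Fact nc_rel_refl : reflexive nc_rel.
Proof. by move=> x; apply/nc_relP; rewrite mulVg; exact: normal_closure1. Qed.

Fact nc_rel_sym : symmetric nc_rel.
Proof.
by move=> x y; apply/nc_relP/nc_relP => /normal_closureV; rewrite invgM invgK.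
Qed.

Fact nc_rel_trans : transitive nc_rel.
Proof.
move=> y x z /nc_relP Nxy /nc_relP Nyz; apply/nc_relP.
by have := normal_closureM Nxy Nyz; rewrite -mulgA (mulgA y) mulgV mul1g.
Qed.

Canonical nc_equiv := EquivRel nc_rel nc_rel_refl nc_rel_sym nc_rel_trans.

(* The quotient of G by the normal closure of S. *)
Definition quot_group : Type := {eq_quot nc_equiv}.

HB.instance Definition _ := Choice.on quot_group.

Definition to_quot (x : G) : quot_group := \pi_({eq_quot nc_equiv}) x.

Lemma to_quotP x y : to_quot x = to_quot y <-> N (x^-1 * y).
Proof.
split=> [/eqmodP/nc_relP //|Nxy].
by apply/eqmodP/nc_relP.
Qed.

Lemma to_quot_repr (q : quot_group) : to_quot (repr (q : {eq_quot nc_equiv})) = q.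
Proof. exact: reprK. Qed.

Let rp (q : quot_group) : G := repr (q : {eq_quot nc_equiv}).
Definition quot_mul (p q : quot_group) : quot_group := to_quot (rp p * rp q).
Definition quot_one : quot_group := to_quot 1.
Definition quot_inv (p : quot_group) : quot_group := to_quot (rp p)^-1.

Lemma quot_mulE x y : quot_mul (to_quot x) (to_quot y) = to_quot (x * y).
Proof.
apply/to_quotP; rewrite invgM.
have /to_quotP Nx : to_quot (rp (to_quot x)) = to_quot x by exact: to_quot_repr.
have /to_quotP Ny : to_quot (rp (to_quot y)) = to_quot y by exact: to_quot_repr.
move: (rp (to_quot x)) (rp (to_quot y)) Nx Ny => x' y' Nx Ny.
have -> : y'^-1 * x'^-1 * (x * y) = (x'^-1 * x) ^ y' * (y'^-1 * y).
  by rewrite /conjg !mulgA mulgK.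
exact: normal_closureM (normal_closureJ _ Nx) Ny.
Qed.

Lemma quot_invE x : quot_inv (to_quot x) = to_quot x^-1.
Proof.
apply/to_quotP; rewrite invgK.
have /to_quotP Nx : to_quot (rp (to_quot x)) = to_quot x by exact: to_quot_repr.
move: (rp _) Nx => x' Nx.
have -> : x' * x^-1 = ((x'^-1 * x) ^ x^-1)^-1.
  by rewrite /conjg !(invgM, invgK, mulgA) mulgV mul1g.
exact/normal_closureV/normal_closureJ.
Qed.

Lemma quotW (P : quot_group -> Prop) : (forall x, P (to_quot x)) -> forall q, P q.
Proof. by move=> PP q; rewrite -(to_quot_repr q). Qed.

Fact quot_mulA : associative quot_mul.
Proof.
by elim/quotW => x; elim/quotW => y; elim/quotW => z; rewrite !quot_mulE mulgA.
Qed.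
Fact quot_mul1g : left_id quot_one quot_mul.
Proof. by elim/quotW => x; rewrite quot_mulE mul1g. Qed.
Fact quot_mulg1 : right_id quot_one quot_mul.
Proof. by elim/quotW => x; rewrite quot_mulE mulg1. Qed.
Fact quot_mulVg : left_inverse quot_one quot_inv quot_mul.
Proof. by elim/quotW => x; rewrite quot_invE quot_mulE mulVg. Qed.
Fact quot_mulgV : right_inverse quot_one quot_inv quot_mul.
Proof. by elim/quotW => x; rewrite quot_invE quot_mulE mulgV. Qed.

HB.instance Definition _ := isGroup.Build quot_group
  quot_mulA quot_mul1g quot_mulg1 quot_mulVg quot_mulgV.

Fact to_quotM : {morph to_quot : x y / x * y}.
Proof. by move=> x y; rewrite -quot_mulE. Qed.

HB.instance Definition _ := isMultiplicative.Build G quot_group to_quot to_quotM.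

End NormalClosure.

(** * Free products *)

Section FreeProduct.
Variables (V : choiceType) (G : V -> groupType).

Definition word : Type := seq {v : V & G v}.

HB.instance Definition _ := gen_eqMixin word.
HB.instance Definition _ := gen_choiceMixin word.

Definition letter v (g : G v) : {v : V & G v} := Tagged (fun v => G v) g.

(* The congruence on words generated by deleting an identity letter and by
   multiplying two adjacent letters of the same group; the classes of words form
   the free product. *)
Inductive word_eq : word -> word -> Prop :=
| word_eq_refl s : word_eq s s
| word_eq_sym s t : word_eq s t -> word_eq t s
| word_eq_trans s t u : word_eq s t -> word_eq t u -> word_eq s u
| word_eq_one s t v : word_eq (s ++ letter (1 : G v) :: t) (s ++ t)
| word_eq_mul s t v (g h : G v) :
    word_eq (s ++ letter g :: letter h :: t) (s ++ letter (g * h) :: t).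

Definition word_rel : rel word := fun s t => `[< word_eq s t >].

Lemma word_relP s t : reflect (word_eq s t) (word_rel s t).
Proof. exact: asboolP. Qed.

Fact word_rel_refl : reflexive word_rel.
Proof. by move=> s; apply/word_relP; constructor. Qed.
Fact word_rel_sym : symmetric word_rel.
Proof. by move=> s t; apply/word_relP/word_relP => /word_eq_sym. Qed.
Fact word_rel_trans : transitive word_rel.
Proof.
by move=> t s u /word_relP st /word_relP tu; apply/word_relP/(word_eq_trans st).
Qed.

Canonical word_equiv :=
  EquivRel word_rel word_rel_refl word_rel_sym word_rel_trans.

Definition free_product : Type := {eq_quot word_equiv}.

HB.instance Definition _ := Choice.on free_product.

Definition to_free (s : word) : free_product := \pi_({eq_quot word_equiv}) s.

Lemma to_freeP s t : to_free s = to_free t <-> word_eq s t.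
Proof.
by split=> [/eqmodP/word_relP //|st]; apply/eqmodP/word_relP.
Qed.

Let rp (q : free_product) : word := repr (q : {eq_quot word_equiv}).

Lemma to_free_repr q : to_free (rp q) = q.
Proof. exact: reprK. Qed.

Lemma freeW (P : free_product -> Prop) :
  (forall s, P (to_free s)) -> forall q, P q.
Proof. by move=> PP q; rewrite -(to_free_repr q). Qed.

Definition word_inv (s : word) : word :=
  rev [seq letter (tagged x : G (tag x))^-1 | x : {v : V & G v} <- s].

Lemma word_eq_catl w s t : word_eq s t -> word_eq (w ++ s) (w ++ t).
Proof.
elim=> {s t} [s|s t _ /word_eq_sym //|s t u _ st _ tu|s t v|s t v g h].
- exact: word_eq_refl.
- exact: word_eq_trans tu.
- by rewrite !catA; exact: word_eq_one.
- by rewrite !catA; exact: word_eq_mul.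
Qed.

Lemma word_eq_catr w s t : word_eq s t -> word_eq (s ++ w) (t ++ w).
Proof.
elim=> {s t} [s|s t _ /word_eq_sym //|s t u _ st _ tu|s t v|s t v g h].
- exact: word_eq_refl.
- exact: word_eq_trans tu.
- by rewrite -!catA; exact: word_eq_one.
- by rewrite -!catA; exact: word_eq_mul.
Qed.

Lemma word_eq_cat s t s' t' :
  word_eq s t -> word_eq s' t' -> word_eq (s ++ s') (t ++ t').
Proof.
by move=> st st'; apply: word_eq_trans (word_eq_catl t st'); exact: word_eq_catr.
Qed.

Lemma word_eq_invl s : word_eq (word_inv s ++ s) [::].
Proof.
elim: s => [|[v g] s IHs]; first exact: word_eq_refl.
rewrite /word_inv /= rev_cons cat_rcons /=.
apply: word_eq_trans IHs.
apply: word_eq_trans (word_eq_mul _ _ _ _) _.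
by rewrite mulVg; exact: word_eq_one.
Qed.

Lemma word_invK : involutive word_inv.
Proof.
move=> s; rewrite /word_inv map_rev revK -map_comp.
by rewrite -[RHS]map_id; apply: eq_map => -[v g] /=; rewrite /letter invgK.
Qed.

Lemma word_eq_invr s : word_eq (s ++ word_inv s) [::].
Proof. by rewrite -{1}(word_invK s); exact: word_eq_invl. Qed.

Lemma word_inv_cat s t : word_inv (s ++ t) = word_inv t ++ word_inv s.
Proof. by rewrite /word_inv map_cat rev_cat. Qed.

Lemma word_eq_inv s t : word_eq s t -> word_eq (word_inv s) (word_inv t).
Proof.
move=> st; have := word_eq_cat (word_eq_cat (word_eq_refl (word_inv t)) st)
  (word_eq_refl (word_inv s)).
rewrite -catA => /word_eq_sym e.
have := word_eq_catl (word_inv t) (word_eq_invr s).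
rewrite cats0 => /(word_eq_trans e).
have := word_eq_catr (word_inv s) (word_eq_invl t) => /word_eq_sym/word_eq_trans.
by move=> /[apply].
Qed.

Definition free_mul (p q : free_product) : free_product := to_free (rp p ++ rp q).
Definition free_one : free_product := to_free [::].
Definition free_inv (p : free_product) : free_product := to_free (word_inv (rp p)).

Lemma rp_to_free s : word_eq (rp (to_free s)) s.
Proof. by apply/to_freeP; exact: to_free_repr. Qed.

Lemma free_mulE s t : free_mul (to_free s) (to_free t) = to_free (s ++ t).
Proof. by apply/to_freeP; apply: word_eq_cat; exact: rp_to_free. Qed.

Lemma free_invE s : free_inv (to_free s) = to_free (word_inv s).
Proof. by apply/to_freeP; apply: word_eq_inv; exact: rp_to_free. Qed.

Fact free_mulA : associative free_mul.
Proof.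
by elim/freeW => x; elim/freeW => y; elim/freeW => z; rewrite !free_mulE catA.
Qed.
Fact free_mul1g : left_id free_one free_mul.
Proof. by elim/freeW => x; rewrite free_mulE. Qed.
Fact free_mulg1 : right_id free_one free_mul.
Proof. by elim/freeW => x; rewrite free_mulE cats0. Qed.
Fact free_mulVg : left_inverse free_one free_inv free_mul.
Proof.
elim/freeW => x; rewrite free_invE free_mulE.
by apply/to_freeP; exact: word_eq_invl.
Qed.
Fact free_mulgV : right_inverse free_one free_inv free_mul.
Proof.
elim/freeW => x; rewrite free_invE free_mulE.
by apply/to_freeP; exact: word_eq_invr.
Qed.

HB.instance Definition _ := isGroup.Build free_product
  free_mulA free_mul1g free_mulg1 free_mulVg free_mulgV.

Definition free_inj v (g : G v) : free_product := to_free [:: letter g].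

Fact free_injM v : {morph @free_inj v : g h / g * h}.
Proof.
move=> g h; apply/esym; rewrite [LHS]free_mulE.
exact/to_freeP/(@word_eq_mul [::] [::]).
Qed.

HB.instance Definition _ v :=
  isMultiplicative.Build (G v) free_product (@free_inj v) (@free_injM v).

End FreeProduct.

(** * Automorphisms *)

Section Automorphisms.
Variable G : groupType.

Record automorphism := Automorphism {
  aut_fun :> G -> G;
  aut_morph : {morph aut_fun : x y / x * y};
  aut_bij : bijective aut_fun }.

HB.instance Definition _ := gen_eqMixin automorphism.
HB.instance Definition _ := gen_choiceMixin automorphism.

Lemma aut_ext (f g : automorphism) : f =1 g -> f = g.
Proof.
case: f g => f fm fb [g gm gb] /= /funext E.
by case: _ / E gm gb => gm gb; congr Automorphism; exact: Prop_irrelevance.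
Qed.

Definition aut_one : automorphism :=
  @Automorphism id (fun _ _ => erefl) (Bijective (fun=> erefl) (fun=> erefl)).

Fact aut_mul_morph (f g : automorphism) : {morph f \o g : x y / x * y}.
Proof. by move=> x y /=; rewrite !aut_morph. Qed.

Definition aut_mul (f g : automorphism) : automorphism :=
  Automorphism (@aut_mul_morph f g) (bij_comp (aut_bij f) (aut_bij g)).

Fact aut_inv_subproof (f : automorphism) :
  {g : automorphism | cancel f g /\ cancel g f}.
Proof.
apply: cid; have [g fgK gfK] := aut_bij f.
have gM : {morph g : x y / x * y}.
  by move=> x y; apply: (can_inj fgK); rewrite aut_morph !gfK.
by exists (Automorphism gM (Bijective gfK fgK)).
Qed.

Definition aut_inv (f : automorphism) : automorphism := sval (aut_inv_subproof f).

Lemma aut_funK (f : automorphism) : cancel f (aut_inv f).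
Proof. by rewrite /aut_inv; case: aut_inv_subproof => g []. Qed.
Lemma aut_invK (f : automorphism) : cancel (aut_inv f) f.
Proof. by rewrite /aut_inv; case: aut_inv_subproof => g []. Qed.

Fact aut_mulA : associative aut_mul.
Proof. by move=> f g h; apply: aut_ext. Qed.
Fact aut_mul1g : left_id aut_one aut_mul.
Proof. by move=> f; apply: aut_ext. Qed.
Fact aut_mulg1 : right_id aut_one aut_mul.
Proof. by move=> f; apply: aut_ext. Qed.
Fact aut_mulVg : left_inverse aut_one aut_inv aut_mul.
Proof. by move=> f; apply: aut_ext => x; exact: aut_funK. Qed.
Fact aut_mulgV : right_inverse aut_one aut_inv aut_mul.
Proof. by move=> f; apply: aut_ext => x; exact: aut_invK. Qed.

HB.instance Definition _ := isGroup.Build automorphism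
  aut_mulA aut_mul1g aut_mulg1 aut_mulVg aut_mulgV.

End Automorphisms.

(** * Graph products and their conjugating automorphisms *)

Section GraphProduct.
Variables (Gam : sgraph) (G : Gam -> groupType).

Definition edge_commutators : set (free_product G) :=
  [set x | exists (u v : Gam) (g : G u) (h : G v),
     adj u v /\ x = [~ free_inj g, free_inj h]].

Definition graph_product : groupType := quot_group edge_commutators.

Definition vertex_inj u (g : G u) : graph_product :=
  to_quot edge_commutators (free_inj g).

Definition factor (u : Gam) : set graph_product := range (@vertex_inj u).

(* x ^ g is g^-1 * x * g. *)
Definition conjugate_set (A : set graph_product) (g : graph_product) :
  set graph_product := [set x ^ g | x in A].

Definition is_pconj : pred (automorphism graph_product) :=
  fun f => `[< forall u, exists g, f @` factor u = conjugate_set (factor u) g >].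

Fact is_pconj_group_closed : group_closed is_pconj.
Proof.
split=> [|f h /asboolP fP /asboolP hP]; apply/asboolP => u.
  exists 1; rewrite /conjugate_set; apply: eq_imagel => x _.
  by rewrite conjg1.
have [k hk] := hP u; have [l fl] := fP u.
pose m := aut_inv h k^-1.
have hVM x y : aut_inv h (x * y) = aut_inv h x * aut_inv h y.
  exact: aut_morph.
have autJ (p : automorphism graph_product) x y : p (x ^ y) = p x ^ p y.
  have p1 : p 1 = 1 by apply: (mulgI (p 1)); rewrite -aut_morph !mulg1.
  have pV z : p z^-1 = (p z)^-1.
    by apply: (mulgI (p z)); rewrite -aut_morph !mulgV.
  by rewrite /conjg !aut_morph pV.
have hVk : aut_inv h @` factor u = conjugate_set (factor u) m.
  rewrite predeqE => x; split.
    case=> y uy <-.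
    have : conjugate_set (factor u) k (y ^ k) by exists y.
    rewrite -hk => -[z uz hz]; exists z => //.
    by rewrite /m -[z in LHS](aut_funK h) -autJ hz -conjgM mulgV conjg1.
  case=> y uy <-.
  have : (h @` factor u) (h y) by exists y.
  rewrite hk => -[z uz zk]; exists z => //.
  by rewrite /m -[y in RHS](aut_funK h) -autJ -zk -conjgM mulgV conjg1.
exists (l * f m).
have -> : (f / h) @` factor u = f @` (aut_inv h @` factor u).
  by rewrite -image_comp.
rewrite hVk predeqE => x; split.
  case=> _ [y uy <-] <-; rewrite autJ.
  have : (f @` factor u) (f y) by exists y.
  by rewrite fl => -[z uz <-]; exists z => //; rewrite conjgM.
case=> y uy <-; rewrite conjgM.
have : conjugate_set (factor u) l (y ^ l) by exists y.
by rewrite -fl => -[z uz <-]; exists (z ^ m); [exists z | rewrite autJ].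
Qed.

(* [is_pconj f] entails that f is conjugating, i.e. that f sends every factor to
   a conjugate of some factor. *)
Definition PConjAut : Type := {f : automorphism graph_product | is_pconj f}.

HB.instance Definition _ := SubChoice.on PConjAut.
HB.instance Definition _ :=
  SubChoice_isSubGroup.Build _ _ PConjAut is_pconj_group_closed.

End GraphProduct.

(** * Group actions on trees *)

Record graph_action (Q : groupType) (T : sgraph) := GraphAction {
  act :> Q -> T -> T;
  act1 : forall x, act 1 x = x;
  actM : forall g h x, act (g * h) x = act g (act h x);
  act_adj : forall g, {mono act g : x y / adj x y} }.

Section Actions.
Variables (Q : groupType) (T : sgraph) (a : graph_action Q T).

(* The action may have inversions: a global fixed point of the geometric
   realisation is either a vertex or the midpoint of an edge, the latter being
   fixed exactly when the edge is stabilised (an interior point other than the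
   midpoint is fixed only together with both endpoints). *)
Definition fixes_vertex (x : T) := forall g, a g x = x.

Definition fixes_midpoint (x y : T) :=
  adj x y /\ forall g, (a g x = x /\ a g y = y) \/ (a g x = y /\ a g y = x).

Definition fixed_point_free :=
  ~ (exists x, fixes_vertex x) /\ ~ (exists x y, fixes_midpoint x y).

(* In a tree, an injective bi-infinite path is a bi-infinite geodesic; a
   loxodromic isometry is one that translates such a line, its axis. *)
Definition is_line (l : int -> T) :=
  injective l /\ forall i : int, adj (l i) (l (i + 1)%R).

Definition is_axis (g : Q) (l : int -> T) :=
  is_line l /\ exists2 n : nat, (0 < n)%N & forall i : int, a g (l i) = l (i + n%:Z)%R.

Definition loxodromic (g : Q) := exists l, is_axis g l.

Definition stab (x : T) : set Q := [set g | a g x = x].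

Definition WPD (g : Q) :=
  loxodromic g /\
  exists l, is_axis g l /\
    exists i j : int, finite_set (stab (l i) `&` stab (l j)).

End Actions.

(* Main.v *)
Require Import Defs.
From HB Require Import structures.
From mathcomp Require Import all_boot all_order all_algebra.
From mathcomp Require Import generic_quotient.
From mathcomp Require Import all_classical.
From mathcomp Require Import zify.

(** Let [u] and [v] be distinct non-adjacent vertices. Killing the other
    vertex-groups turns the graph product into the free product of [G u] and
    [G v]. A partially conjugating automorphism permutes the conjugates of every
    other vertex-group, hence preserves the kernel and induces an automorphism [f]
    of the free product, still mapping each of the two factors to a conjugate of
    itself. [Q] is the group of these [f], and [T] is the Bass-Serre tree, whose
    vertices are the left cosets of the two factors and whose edges are the
    elements of the free product.

    The group [Q] acts on [T] because a single element [k] conjugates both factors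
    to their images under [f] ([simultaneous_conj]): the images generate, whereas
    the factor [G u] and the conjugate of [G v] by a reduced word that starts in
    [G u] and ends in [G v] play ping-pong and generate too small a subgroup
    ([side_conj_not_generate]). As the factors are their own normalisers and meet
    trivially, [k] is unique, so mapping the coset of [g] to the coset of [f g * k]
    is an action.
    It extends the action of the free product by inner automorphisms, which fixes
    no vertex, and it preserves the two types of vertices, so it inverts no edge.

    If the vertex-groups are finitely generated, let [w] be an alternating word
    containing generators of both factors. The inner automorphism by [w]
    translates the line of [T] spelled by the powers of [w]. An element of [Q]
    fixing two vertices of that line one period apart fixes every letter of [w],
    by uniqueness of normal forms ([alternating_rigid]); it is then the identity,
    so the two stabilisers meet trivially. *)

Set Implicit Arguments.
Unset Strict Implicit.
Unset Printing Implicit Defensive.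

Local Open Scope classical_set_scope.
Local Open Scope quotient_scope.
Local Open Scope group_scope.

(** * Splittings of a group as a free product of two subgroups *)

Definition subgroup_set (F : groupType) (H : set F) :=
  H 1 /\ forall x y, H x -> H y -> H (x / y).

Definition generates (F : groupType) (S : set F) :=
  forall H : set F, subgroup_set H -> S `<=` H -> forall x, H x.

(** The two free factors are [side true] and [side false], and [starts t] is the
    set of elements whose normal form begins with a letter of [side t]. The last
    field is the ping-pong condition, which makes the product free; it is used in
    place of uniqueness of normal forms. *)
Record free_splitting (F : groupType) := FreeSplitting {
  side : bool -> set F;
  starts : bool -> set F;
  side_subgroup : forall t, subgroup_set (side t);
  side_neq1 : forall t, exists2 x, side t x & x != 1;
  side_generate : generates [set x | exists t, side t x];
  starts_neq1 : forall t, ~ starts t 1;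
  starts_disjoint : forall t x, starts t x -> ~ starts (~~ t) x;
  starts_mul : forall t x y, side t x -> x != 1 -> ~ starts t y ->
    starts t (x * y) }.

Section Splitting.
Variables (F : groupType) (S : free_splitting F).
Notation X := (side S).
Notation P := (starts S).

Lemma side1 t : X t 1.
Proof. by case: (side_subgroup S t). Qed.

Lemma sideF t x y : X t x -> X t y -> X t (x / y).
Proof. by case: (side_subgroup S t) => _; apply. Qed.

Lemma sideV t x : X t x -> X t x^-1.
Proof. by move=> /(sideF (side1 t)); rewrite mul1g. Qed.

Lemma sideM t x y : X t x -> X t y -> X t (x * y).
Proof. by move=> Xx /sideV/(sideF Xx); rewrite invgK. Qed.

Lemma sideMl t x y : X t x -> X t (x * y) <-> X t y.
Proof.
move=> Xx; split=> [|/(sideM Xx)//].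
by move/(sideM (sideV Xx)); rewrite mulKg.
Qed.

Lemma side_starts t x : X t x -> x != 1 -> P t x.
Proof.
by move=> Xx x1; rewrite -[x]mulg1; apply: starts_mul => //; exact: starts_neq1.
Qed.

Lemma starts_side t t' x : X t x -> P t' x -> t = t'.
Proof.
move=> Xx Px; have x1 : x != 1.
  by apply/eqP => x1; rewrite x1 in Px; exact: starts_neq1 Px.
have := side_starts Xx x1 => /(@starts_disjoint _ S).
by case: t t' Px {Xx} => -[] // Px [].
Qed.

Lemma starts_inj t t' x : P t x -> P t' x -> t = t'.
Proof. by move=> /(@starts_disjoint _ S); case: t t' => -[]. Qed.

Lemma side_inter x : X true x -> X false x -> x = 1.
Proof.
move=> Xt Xf; apply/eqP; apply/negPn/negP => x1.
by have := starts_side Xf (side_starts Xt x1).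
Qed.

(** * Alternating words *)

Fixpoint alternating (t : bool) (s : seq F) : Prop :=
  if s is x :: s' then [/\ X t x, x != 1 & alternating (~~ t) s'] else True.

(** Evaluation of an alternating word after replacing each letter of [side t] by
    its image under [th t]. *)
Fixpoint eval (th : bool -> F -> F) (t : bool) (s : seq F) : F :=
  if s is x :: s' then th t x * eval th (~~ t) s' else 1.

(** Prefixing a letter of either side to an alternating word gives, after merging
    or cancelling, an alternating word; hence left multiplication by generators
    preserves the set of values of alternating words. *)
Lemma alternating_onto (th : bool -> F -> F) :
    (forall t x y, X t x -> X t y -> th t (x * y) = th t x * th t y) ->
    generates [set z | exists t x, X t x /\ z = th t x] ->
  forall z, exists t s, alternating t s /\ z = eval th t s.
Proof.
move=> thM gen.
have th1 t : th t 1 = 1.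
  by apply: (mulgI (th t 1)); rewrite -thM ?mulg1 //; exact: side1.
pose E z := exists t s, alternating t s /\ z = eval th t s.
have EM t x z : X t x -> E z -> E (th t x * z).
  move=> Xx [t' [s [alt ->]]].
  have [->|x1] := eqVneq x 1; first by rewrite th1 mul1g; exists t', s.
  have [tt'|ntt'] := eqVneq t' t; last first.
    exists t, (x :: s); split => //=; last by case: t t' ntt' {Xx alt} => -[].
    by split => //; case: t t' ntt' alt {Xx} => -[].
  case: s alt => [|y s] alt; first by exists t, [:: x]; subst t'.
  subst t'; case: alt => Xy y1 alt /=; rewrite mulgA -thM //.
  have [->|xy1] := eqVneq (x * y) 1; first by rewrite th1 mul1g; exists (~~ t), s.
  by exists t, (x * y :: s); split => //; split => //; exact: sideM.
pose H : set F := [set h | forall z, E z <-> E (h * z)].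
have Hall z0 : H z0.
  apply: (gen H) => [|_ [t [x [Xx ->]]] z].
    split=> [z|x y Hx Hy z]; first by rewrite mul1g.
    have := Hx (y^-1 * z); have := Hy (y^-1 * z); rewrite mulVKg mulgA => <-.
    by move=> ->.
  apply: conj => [/(EM _ _ _ Xx)|] //.
  move/(EM _ _ _ (sideV Xx)); rewrite mulgA -thM //; last exact: sideV.
  by rewrite mulVg th1 mul1g.
move=> z; have : E 1 by exists true, [::].
by move/(Hall z 1); rewrite mulg1.
Qed.

Notation prod := (eval (fun=> id)).

Lemma prodS t x s : prod t (x :: s) = x * prod (~~ t) s.
Proof. by []. Qed.

Lemma alternating_prod z : exists t s, alternating t s /\ z = prod t s.
Proof.
apply: alternating_onto => // H HF sH x; apply: (@side_generate _ S) => // y [t Xy].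
by apply: sH; exists t, y.
Qed.

Lemma starts_prod t x s : alternating t (x :: s) -> P t (prod t (x :: s)).
Proof.
elim: s t x => [|y s IHs] t x.
  by case=> Xx x1 _ /=; rewrite mulg1; exact: side_starts.
case=> Xx x1 alt; apply: starts_mul => // /(@starts_disjoint _ S); apply.
exact: IHs.
Qed.

Lemma startsE t z : P t z -> exists x s, alternating t (x :: s) /\ z = prod t (x :: s).
Proof.
have [t' [[|x s] [alt ->]]] := alternating_prod z; first by move/starts_neq1.
by move=> Pt; have e := starts_inj (starts_prod alt) Pt; subst t'; exists x, s.
Qed.

Lemma starts_cases z : [\/ z = 1, P true z | P false z].
Proof.
have [t [[|x s] [alt ->]]] := alternating_prod z; first by constructor 1.
by move/starts_prod: alt; case: t; [constructor 2|constructor 3].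
Qed.

Lemma starts_factor t z : P t z ->
  exists x y, [/\ z = x * y, X t x, x != 1 & y = 1 \/ P (~~ t) y].
Proof.
case/startsE => x [s [[Xx x1 alt] ->]]; exists x, (prod (~~ t) s); split => //.
by case: s alt => [|y s alt]; [left | right; exact: starts_prod].
Qed.

(** * Products of normal forms *)

(** Multiplying on the right by one letter changes the first letter only if the
    normal form has a single letter, of the same side. *)
Lemma starts_mulr t t' x y : P t x -> X t' y -> P t (x * y) \/ X t (x * y).
Proof.
case/startsE => z [s [+ ->]] Xy {x}; elim: s t z => [|z' s IHs] t z.
  case=> Xz z1 _ /=; rewrite mulg1.
  have [e|ne] := eqVneq t' t; first by right; subst t'; exact: sideM.
  by left; apply: starts_mul => // /(starts_side Xy) e; rewrite e eqxx in ne.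
case=> Xz z1 alt; left; have IH := IHs (~~ t) z' alt.
rewrite prodS -mulgA; apply: starts_mul => // Pt.
case: IH => [/(@starts_disjoint _ S)|/starts_side/(_ Pt)]; rewrite ?negbK //.
by case: (t).
Qed.

(** The last letter of [u] is inverse to the first letter of [u^-1], so the
    hypotheses say that nothing cancels or merges between [u] and [z]. *)
Lemma starts_cat t t' u z : P t u -> P t' u^-1 -> ~ P t' z -> P t (u * z).
Proof.
case/startsE => x [s [+ ->]] {u}; elim: s t x => [|y s IHs] t x.
  case=> Xx x1 _ /=; rewrite mulg1 => Px nPz.
  by have e := starts_side (sideV Xx) Px; subst t'; exact: starts_mul.
case=> Xx x1 alt; rewrite prodS invgM -mulgA.
set v := prod _ _ => Pvx nPz; apply: starts_mul => //.
suff: P (~~ t) (v * z) by move=> /(@starts_disjoint _ S); rewrite negbK.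
apply: IHs => //; have Pv : P (~~ t) v by exact: starts_prod.
have [t'' Pv'] : exists t'', P t'' v^-1.
  case: (starts_cases v^-1) => [/eqP|?|?]; [|by exists true|by exists false].
  by rewrite invg_eq1 => /eqP v1; rewrite v1 in Pv; case: (starts_neq1 Pv).
case: (starts_mulr Pv' (sideV Xx)) => [/starts_inj/(_ Pvx) <- //|].
by move=> /starts_side/(_ Pvx) <-.
Qed.

(** Otherwise [k = y * z] with [y] in [side t] and [z] starting on the other side;
    for [x] in the factor, [x ^ y * z = z * x ^ k] then starts on one side when
    read on the left and on the other when read on the right. *)
Lemma side_normaliser t k : (forall x, X t x -> X t (x ^ k)) -> X t k.
Proof.
move=> Nk; have [x Xx x1] := side_neq1 S t.
have main y z : X t y -> k = y * z -> P (~~ t) z -> False.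
  move=> Xy ek Pz; have Xx' : X t (x ^ y).
    by rewrite conjgE; apply: sideM; [exact: sideV|exact: sideM].
  have x'1 : x ^ y != 1 by rewrite conjg_eq1.
  have /starts_mul := Xx' => /(_ z x'1).
  have nPz : ~ P t z by move/(@starts_disjoint _ S).
  move=> /(_ nPz); rewrite conjgC -conjgM -ek.
  have := Nk _ Xx => /(starts_mulr Pz) [/starts_inj h /h|/starts_side h /h];
  by case: (t).
have [] : [\/ k = 1, P t k | P (~~ t) k].
- by case: (starts_cases k) => ?; case: (t);
    by [constructor 1|constructor 2|constructor 3].
- by move=> ->; exact: side1.
- case/starts_factor => y [z [ek Xy _ [z1|Pz]]]; last by case: (main y z).
  by rewrite ek z1 mulg1.
- by move=> Pk; case: (main 1 k) => //; [exact: side1|rewrite mul1g].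
Qed.

(** * Conjugates of the two factors that generate *)

(** If the normal form of [w] starts in [side true] and ends in [side false], then
    [side true] and the conjugate of [side false] by [w] play ping-pong on the set
    [C] of those [x] for which [w * x] does not start in [side true], and its
    complement. So every product of their elements is an element of [side true]
    times [1] or an element of [C]. A non-trivial element of [side false] has no
    such form. *)
Lemma side_conj_not_generate w : P true w -> P false w^-1 ->
  ~ generates [set z | exists t x, X t x /\ z = x ^ (if t then 1 else w)].
Proof.
move=> Pw PwV gen; pose C x := ~ P true (w * x).
have nC1 : ~ C 1 by apply; rewrite mulg1.
have CP x : C x -> P false x.
  by move=> Cx; rewrite -(mulKg w x); apply: starts_cat PwV _ Cx; rewrite invgK.
have nCM x y : X true x -> x != 1 -> y = 1 \/ C y -> ~ C (x * y).
  move=> Xx x1 y1C; apply; apply: starts_cat Pw PwV _.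
  suff /(@starts_disjoint _ S) : P true (x * y) by [].
  apply: starts_mul => //; case: y1C => [->|/CP/(@starts_disjoint _ S)//].
  exact: starts_neq1.
have CM x y : X false x -> x != 1 -> ~ C y -> C (x ^ w * y).
  move=> Xx x1 /notP Py Pxy; have := starts_mul Xx x1 (@starts_disjoint _ S true _ Py).
  move/(@starts_disjoint _ S); apply; move: Pxy.
  by rewrite /C conjgE !mulgA mulgV mul1g.
pose th t x := x ^ (if t then 1 else w).
have thE t s : alternating t s ->
   eval th t s = 1 /\ s = [::] \/
   (if t then exists x y, [/\ eval th t s = x * y, X true x, x != 1 & y = 1 \/ C y]
    else C (eval th t s)).
  elim: s t => [|x s IHs] t; first by left.
  case=> Xx x1 /IHs IH; right; rewrite /= {1}/th.
  case: t Xx IH => /= Xx IH.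
    exists x, (eval th false s); rewrite conjg1; split=> //.
    by case: IH => [[-> _]|]; [left|right].
  apply: CM => //; case: IH => [[-> _] //|[y [z [-> Xy y1 zC]]]].
  exact: nCM.
have [b Xb b1] := side_neq1 S false.
have Pb := side_starts Xb b1.
have [] := @alternating_onto th _ gen b.
  by move=> t x y _ _; rewrite /th conjMg.
move=> t [s [/thE + eb]]; rewrite -eb => -[[e _]|]; first by rewrite e eqxx in b1.
case: t {eb} => [[x [y [eb Xx x1 yC]]]|Cb].
  have : P true (x * y).
    apply: starts_mul => //; case: yC => [->|/CP/(@starts_disjoint _ S)//].
    exact: starts_neq1.
  by rewrite -eb; move/(@starts_disjoint _ S).
apply: Cb; case: (starts_mulr Pw Xb) => // Xwb.
apply: side_starts => //; apply/eqP => /mulg1_eq wb.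
by have := starts_side (sideV Xb) => /(_ true); rewrite -wb invgK => /(_ Pw).
Qed.

(** Strip the first letter of [d] if it is in [side false], then the last one if it
    is in [side true]. *)
Lemma double_coset_reduced d : exists b w a,
  [/\ d = b * w * a, X false b, X true a & w = 1 \/ P true w /\ P false w^-1].
Proof.
have strip y : P true y -> exists w a,
    [/\ y = w * a, X true a & w = 1 \/ P true w /\ P false w^-1].
  move=> Py; case: (starts_cases y^-1) => [/eqP|PyV|PyV].
  - by rewrite invg_eq1 => /eqP e; rewrite e in Py; case: (starts_neq1 Py).
  - have [a [z [eyV Xa a1 z1P]]] := starts_factor PyV.
    exists z^-1, a^-1; rewrite invgK -invgM -eyV invgK; split=> //; first exact: sideV.
    case: z1P => [->|Pz]; [by left; rewrite invg1|right; split=> //].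
    have ey : y = z^-1 * a^-1 by rewrite -invgM -eyV invgK.
    case: (starts_cases z^-1) => [/eqP| //|PzV].
      by rewrite invg_eq1 => /eqP e; rewrite e in Pz; case: (starts_neq1 Pz).
    case: (starts_mulr PzV (sideV Xa)); rewrite -ey.
      by move/(@starts_disjoint _ S).
    by move/starts_side => /(_ _ Py).
  - by exists y, 1; rewrite mulg1; split=> //; [exact: side1|right].
case: (starts_cases d) => [->|Pd|Pd].
- by exists 1, 1, 1; rewrite !mulg1; split=> //; [exact: side1|exact: side1|left].
- have [w [a [-> Xa wP]]] := strip _ Pd.
  by exists 1, w, a; rewrite mul1g; split=> //; exact: side1.
- have [b [y [-> Xb b1 [->|Py]]]] := starts_factor Pd.
    by exists b, 1, 1; rewrite !mulg1; split=> //; [exact: side1|left].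
  have [w [a [-> Xa wP]]] := strip _ Py.
  by exists b, w, a; rewrite mulgA.
Qed.

Lemma generates_conj (Y : set F) k :
  generates [set y ^ k | y in Y] -> generates Y.
Proof.
move=> gen H [H1 HF] sH x.
suff: [set z | H (z ^ k^-1)] (x ^ k) by rewrite /= -conjgM mulgV conjg1.
apply: gen => [|_ [y Yy <-]]; last by rewrite /= -conjgM mulgV conjg1; exact: sH.
split=> [|y z Hy Hz] /=; first by rewrite conj1g.
by rewrite conjMg conjVg; exact: HF.
Qed.

Lemma side_conj t x y : X t y -> X t x -> X t (x ^ y).
Proof. by move=> Xy Xx; rewrite conjgE; apply: sideM; [exact: sideV|exact: sideM]. Qed.

(** Left factors of [g t] in [side t] do not affect the conjugate of [side t] by
    [g t]. Up to these, and to conjugating everything by a single element, the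
    first conjugating element is [1] and the second is a word as in
    [side_conj_not_generate], unless it is [1] too. *)
Lemma simultaneous_conj (g : bool -> F) :
    generates [set z | exists t x, X t x /\ z = x ^ g t] ->
  exists k, forall t, exists2 y, X t y & g t = y * k.
Proof.
move=> gen.
have [b [w [a [ed Xb Xa wP]]]] := double_coset_reduced (g false / g true).
pose k := a * g true; have gt : g true = a^-1 * k by rewrite mulKg.
have gf : g false = b * w * k by rewrite mulgA -ed mulgVK.
case: wP => [w1|[Pw PwV]].
  exists k => -[]; first by exists a^-1 => //; exact: sideV.
  by exists b => //; rewrite gf w1 mulg1.
case: (side_conj_not_generate Pw PwV); apply: (@generates_conj _ k).
move=> H HF sH x; apply: gen => // _ [t [y [Xy ->]]]; apply: sH.
case: t Xy => Xy.
  exists (y ^ a^-1); last by rewrite -conjgM -gt.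
  exists true, (y ^ a^-1); rewrite conjg1; split=> //.
  by apply: side_conj => //; exact: sideV.
exists (y ^ (b * w)); last by rewrite -conjgM -gf.
by exists false, (y ^ b); rewrite conjgM; split=> //; exact: side_conj.
Qed.

End Splitting.

(** * The tree of a free splitting *)

Section Tree.
Variables (F : groupType) (S : free_splitting F).
Notation X := (side S).
Notation P := (starts S).

Definition coset t (g : F) : set F := [set h | X t (g^-1 * h)].

Definition is_coset : pred (bool * set F) :=
  fun p => `[< exists g, p.2 = coset p.1 g >].

Definition coset_vertex : Type := {p : bool * set F | is_coset p}.
HB.instance Definition _ := SubChoice.on coset_vertex.

Fact cosetv_subproof t g : is_coset (t, coset t g).
Proof. by apply/asboolP; exists g. Qed.

Definition cosetv t g : coset_vertex :=
  @exist _ is_coset (t, coset t g) (cosetv_subproof t g).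

Definition vtype (x : coset_vertex) : bool := (val x).1.

Lemma cosetvW (x : coset_vertex) : exists g, x = cosetv (vtype x) g.
Proof.
case: x => -[t A] /= xP; have /asboolP[g /= e] := xP.
by exists g; apply: val_inj; congr pair; exact: e.
Qed.

Lemma cosetvP t g h : cosetv t g = cosetv t h <-> X t (g^-1 * h).
Proof.
split=> [/(congr1 (fun x => (val x).2 h)) /= e|Xgh].
  by have : coset t h h by [rewrite /coset /= mulVg; exact: side1]; rewrite -e.
apply: val_inj; congr pair; rewrite predeqE => k; rewrite /coset /=.
have -> : g^-1 * k = (g^-1 * h) * (h^-1 * k) by rewrite -mulgA mulVKg.
exact: sideMl.
Qed.

(** The element [g] is the edge between the cosets of the two factors by [g]. *)
Definition coset_adj : rel coset_vertex :=
  fun x y => `[< exists t g, x = cosetv t g /\ y = cosetv (~~ t) g >].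

Lemma coset_adjP x y :
  reflect (exists t g, x = cosetv t g /\ y = cosetv (~~ t) g) (coset_adj x y).
Proof. exact: asboolP. Qed.

Fact coset_adj_sym : symmetric coset_adj.
Proof.
by move=> x y; apply/coset_adjP/coset_adjP => -[t [g [-> ->]]];
  exists (~~ t), g; rewrite negbK.
Qed.

Fact coset_adj_irr : irreflexive coset_adj.
Proof.
by move=> x; apply/coset_adjP => -[t [g [-> /(congr1 vtype)/=]]]; case: t.
Qed.

Definition coset_tree : sgraph := SGraph coset_adj_sym coset_adj_irr.

Lemma coset_connected : connected_graph coset_tree.
Proof.
pose R (x y : coset_tree) :=
  exists2 p : seq coset_tree, path (@adj coset_tree) x p & last x p = y.
have R1 x : R x x by exists [::].
have RT x y z : R x y -> R y z -> R x z.
  by move=> [p xp <-] [q yq <-]; exists (p ++ q); rewrite ?cat_path ?xp ?last_cat.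
have RE t g : R (cosetv t g) (cosetv (~~ t) g).
  exists [:: cosetv (~~ t) g] => //=; rewrite andbT.
  by apply/coset_adjP; exists t, g.
have RE' t t' g : R (cosetv t g) (cosetv t' g).
  by have [<-//|] := eqVneq t t'; case: t t' => -[] // _; exact: RE.
pose H : set F := [set x | forall g t, R (cosetv t g) (cosetv t (g * x)) /\
  R (cosetv t (g * x)) (cosetv t g)].
have HX : forall x, H x.
  apply: (@side_generate _ S) => [|x [t' Xx] g t].
    split=> [g t|x y Hx Hy g t]; first by rewrite mulg1.
    have [y1 y2] := Hy (g * (x / y)) t; have [x1 x2] := Hx g t.
    rewrite -!mulgA mulVg mulg1 in y1 y2.
    by split; [exact: RT x1 y2|exact: RT y1 x2].
  have e : cosetv t' g = cosetv t' (g * x) by apply/cosetvP; rewrite mulKg.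
  split; apply: RT (RE' t t' _) _; first by rewrite e.
  by rewrite -e.
move=> x y; have [g ->] := cosetvW x; have [h ->] := cosetvW y.
apply: RT (RE' _ (vtype y) _) _.
by have [+ _] := HX (g^-1 * h) g (vtype y); rewrite mulVKg.
Qed.

(** The successive edges of a path without backtracking differ by letters that
    alternate between the two sides. *)
Lemma path_edge t (k : F) (y : coset_tree) (p : seq coset_tree) :
    y = cosetv (~~ t) k -> path (@adj coset_tree) y p -> uniq (y :: p) ->
    head y p != cosetv t k ->
  exists m t', last y p = cosetv t' (k * m) /\
    (p = [::] /\ m = 1 /\ t' = ~~ t \/ P (~~ t) m).
Proof.
elim: p t k y => [|z p IHp] t k y ey.
  by exists 1, (~~ t); rewrite mulg1; split; [|left].
case/andP=> /coset_adjP[t1 [k' [ey' ez]]] zp.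
rewrite [uniq _]/= in_cons negb_or -andbA => /and4P[yz yp zp' up] /= nb.
have et : t1 = ~~ t by have := congr1 vtype ey'; rewrite ey.
rewrite et negbK in ey' ez.
have Xa : X (~~ t) (k^-1 * k') by apply/cosetvP; rewrite -ey.
have a1 : k^-1 * k' != 1.
  by apply: contraNneq nb => /mulg1_eq; rewrite invgK ez => ->.
have [] := IHp (~~ t) k' z; rewrite ?negbK //.
- by rewrite /= zp'.
- case: (p) yp yz => [|z' q] /=; rewrite -ey' 1?eq_sym // in_cons negb_or eq_sym.
  by case/andP.
move=> m [t' [lastE mP]]; exists (k^-1 * k' * m), t'; split.
  by rewrite mulgA mulVKg.
right; apply: starts_mul => //; case: mP => [[_ [-> _]]|]; first exact: starts_neq1.
by move=> Pt /(@starts_disjoint _ S); rewrite negbK.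
Qed.

(** If a cycle passes from a coset [g * side t] to the adjacent coset by the edge
    [g] and comes back, the edge by which it comes back is [g * m] with [m] in
    [side t], although [m] starts on the other side. *)
Lemma coset_acyclic : acyclic coset_tree.
Proof.
case=> [//|x [//|y [//|z p]]] /andP[] /andP[+ pc] uc.
case/coset_adjP => t [k [ex ey]].
have uc' : uniq (y :: rcons (z :: p) x).
  by move: uc; rewrite -[y :: rcons _ _]/(rcons (y :: z :: p) x) rcons_uniq.
have zx : head y (rcons (z :: p) x) != cosetv t k.
  by rewrite /= -ex eq_sym; move: uc; rewrite /= !in_cons !negb_or => /andP[/and3P[]].
have [m [t' [+ mP]]] := @path_edge t k y (rcons (z :: p) x) ey pc uc' zx.
rewrite last_rcons ex => e.
have et : t = t' by exact: (congr1 vtype e).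
subst t'; move/cosetvP: e; rewrite mulKg => Xm.
case: mP => [[//]|/(starts_side Xm)]; by case: (t).
Qed.

Lemma coset_is_tree : is_tree coset_tree.
Proof.
split; [exact: inhabits (cosetv true 1)|exact: coset_connected|exact: coset_acyclic].
Qed.

(** * Automorphisms preserving the splitting up to conjugacy *)

(** [f] maps each of the two factors onto its conjugate by [k^-1]. *)
Definition adapted (f : automorphism F) (k : F) :=
  forall t x, X t x <-> X t (f x ^ k).

Lemma aut_1 (G : groupType) (f : automorphism G) : f 1 = 1.
Proof. by apply: (mulgI (f 1)); rewrite -aut_morph !mulg1. Qed.

Lemma aut_V (G : groupType) (f : automorphism G) x : f x^-1 = (f x)^-1.
Proof. by apply: (mulgI (f x)); rewrite -aut_morph !mulgV aut_1. Qed.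

Lemma aut_J (G : groupType) (f : automorphism G) x y : f (x ^ y) = f x ^ f y.
Proof. by rewrite !conjgE !aut_morph aut_V. Qed.

Lemma adapted1 : adapted 1 1.
Proof. by move=> t x; rewrite conjg1. Qed.

Lemma adaptedM f k h l : adapted f k -> adapted h l -> adapted (f * h) (f l * k).
Proof. by move=> fk hl t x; rewrite conjgM /= -aut_J -(fk t) -(hl t). Qed.

(** The quotient of two candidates normalises both factors, hence lies in both. *)
Lemma adapted_uniq f k k' : adapted f k -> adapted f k' -> k = k'.
Proof.
have N t l l' : adapted f l -> adapted f l' -> X t (l^-1 * l').
  move=> fl fl'; apply: side_normaliser => y Xy.
  have ey : (f (aut_inv f (y ^ l^-1))) ^ l = y by rewrite aut_invK -conjgM mulVg conjg1.
  have : X t (aut_inv f (y ^ l^-1)) by apply/(fl t); rewrite ey.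
  by move/(fl' t); rewrite aut_invK -conjgM.
move=> fk fk'; apply/eqP; rewrite -(inj_eq (mulgI k^-1)) mulVg eq_sym.
by apply/eqP; apply: (side_inter (S := S)); exact: N.
Qed.

Lemma adapted_exists (f : automorphism F) (g : bool -> F) :
    (forall t, f @` X t = [set x ^ g t | x in X t]) ->
  exists k, adapted f k.
Proof.
move=> fX; have [|k kP] := @simultaneous_conj _ S g.
  move=> H [H1 HF] sH z; rewrite -(aut_invK f z).
  apply: (@side_generate _ S [set x | H (f x)]); last first.
    move=> x [t Xx]; apply: sH; have : (f @` X t) (f x) by exists x.
    by rewrite fX => -[y Xy <-]; exists t, y.
  split=> [|x y Hx Hy] /=; first by rewrite aut_1.
  by rewrite aut_morph aut_V; exact: HF.
exists k^-1 => t x; have [y Xy gt] := kP t.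
have XJ z : X t (z ^ y) <-> X t z.
  split=> [/(side_conj (sideV Xy))|]; last exact: side_conj.
  by rewrite -conjgM mulgV conjg1.
split=> [Xx|Xfx].
  have : (f @` X t) (f x) by exists x.
  rewrite fX gt => -[z Xz <-].
  by rewrite -conjgM -mulgA mulgV mulg1; apply/XJ.
have : [set x ^ g t | x in X t] (f x).
  exists (f x ^ (k^-1 * y^-1)); last by rewrite -conjgM gt -mulgA mulKg mulVg conjg1.
  by apply/XJ; rewrite -conjgM -mulgA mulVg mulg1.
rewrite -fX => -[z Xz /(can_inj (aut_funK f)) <-] //.
Qed.

Lemma adapted_letter f k t x : adapted f k -> X t x -> x != 1 ->
  X t (f x ^ k) /\ f x ^ k != 1.
Proof.
move=> fk Xx x1; split; first exact: (proj1 (fk t x)).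
by rewrite conjg_eq1; apply: contraNneq x1 => fx; rewrite -(aut_funK f x) fx aut_1 eqxx.
Qed.
End Tree.

(** * Rigidity of normal forms *)

Section Words.
Variables (F : groupType) (S : free_splitting F).
Notation X := (side S).
Notation P := (starts S).
Notation prod := (eval (fun=> id)).

Lemma prod_big t (s : seq F) : prod t s = \prod_(x <- s) x.
Proof. by elim: s t => [|x s IHs] t; rewrite ?big_nil // big_cons -(IHs (~~ t)). Qed.

(** Neither [k] nor [y] can be absorbed by the alternating word next to it: [k]
    lies on the side opposite to the first letter, [y] on that opposite to the
    last. *)
Lemma alternating_rigid t s s' k y :
    size s = size s' -> alternating S t s -> alternating S t s' ->
    X (~~ t) k -> X (t (+) odd (size s)) y ->
    prod t s = k * (prod t s' * y) ->
  k = 1 /\ s = s'.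
Proof.
elim: s s' t k => [|a s IHs] [|a' s'] // t k.
  move=> _ _ _ Xk; rewrite addbF /= mul1g => Xy /esym/mulg1_eq ky; split=> //.
  have {ky}Xk' : X t k by move: (sideV Xy); rewrite -ky invgK.
  by case: t Xk Xk' {Xy} => ? ?; exact: (side_inter (S := S)).
case=> size_s alt alt' Xk Xy e.
have k1 : k = 1.
  apply/eqP/negPn/negP => k1; have Ps := starts_prod alt; rewrite e in Ps.
  suff /(starts_mul Xk k1)/starts_inj/(_ Ps) : ~ P (~~ t) (prod t (a' :: s') * y).
    by case: (t).
  case: (starts_mulr (starts_prod alt') Xy) => [/(@starts_disjoint _ S)//|].
  by move=> /starts_side h /h; case: (t).
have [Xa _ {}alt] := alt; have [Xa' _ {}alt'] := alt'.
have [|||aa' ->] := IHs s' (~~ t) (a^-1 * a') size_s alt alt'.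
- by rewrite negbK; apply: sideM => //; exact: sideV.
- by move: Xy; rewrite /= addbN addNb.
- move: e; rewrite k1 mul1g !prodS -mulgA => /(canRL (mulKg a)) ->.
  by rewrite !mulgA.
by split=> //; congr cons; rewrite -[RHS](mulVKg a) aa' mulg1.
Qed.

(** Padding with fixed non-trivial letters makes any finite list of letters occur
    in one cyclically alternating word. *)
Lemma alternating_cover (l : seq F) : (forall x, x \in l -> exists t, X t x) ->
  exists s, [/\ alternating S true s, ~~ odd (size s), (0 < size s)%N &
                forall x, x \in l -> x != 1 -> x \in s].
Proof.
have [a Xa a1] := side_neq1 S true; have [b Xb b1] := side_neq1 S false.
elim: l => [_|x l IHl Xl]; first by exists [:: a; b].
have [y yl|s [alt odd_s s_gt0 sl]] := IHl; first by apply: Xl; rewrite in_cons yl orbT.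
have [x1|x1] := eqVneq x 1.
  exists s; split=> // y; rewrite in_cons => /orP[/eqP ->|]; last exact: sl.
  by rewrite x1 eqxx.
have [t Xx] := Xl x (mem_head _ _).
exists (if t then [:: x, b & s] else [:: a, x & s]).
split; try by case: t Xx => Xx //=; rewrite negbK.
move=> y; rewrite in_cons => /orP[/eqP ->|yl] y1.
  by case: (t); rewrite !in_cons eqxx ?orbT.
by case: (t); rewrite !in_cons sl ?orbT.
Qed.

(** * The line spelled by a periodic word *)

Section Line.
Variable s : seq F.
Hypotheses (alt : alternating S true s) (even_s : ~~ odd (size s)).
Hypothesis s_gt0 : (0 < size s)%N.

Let N := size s.
Let c i := nth 1 s (i %% N).
Let E n := \prod_(0 <= i < n) c i.
Let h := E N.

Lemma odd_period i m : odd (i + m * N) = odd i.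
Proof. by rewrite oddD oddM (negbTE even_s) andbF addbF. Qed.

Lemma alternating_nth t (r : seq F) i : alternating S t r -> (i < size r)%N ->
  X (t (+) odd i) (nth 1 r i) /\ nth 1 r i != 1.
Proof.
move: r t i; elim=> [//|x r IHr] t [|i] [Xx x1 altr] /= ir; first by rewrite addbF.
by rewrite addbN -addNb; exact: IHr.
Qed.

Lemma letter_side i : X (~~ odd i) (c i) /\ c i != 1.
Proof.
have <- : odd (i %% N) = odd i by rewrite [in RHS](divn_eq i N) addnC odd_period.
by apply: (alternating_nth alt); rewrite ltn_mod.
Qed.

Lemma segment_starts m n : (m < n)%N -> P (~~ odd m) (\prod_(m <= i < n) c i).
Proof.
move=> mn; rewrite -(subnKC mn); move: (n - m.+1)%N => d {n mn}; elim: d m => [|d IHd] m.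
  by rewrite addn0 big_nat1; have [Xc c1] := letter_side m; exact: side_starts.
rewrite big_ltn ?ltn_addr //; have [Xc c1] := letter_side m; apply: starts_mul => //.
by move: (IHd m.+1); rewrite addSnnS => /(@starts_disjoint _ S); rewrite /= negbK.
Qed.

Lemma prefix_cat m n : (m <= n)%N -> (E m)^-1 * E n = \prod_(m <= i < n) c i.
Proof. by move=> mn; rewrite [E n](@big_cat_nat _ _ _ m) //= mulKg. Qed.

Lemma prefix_period m n : E (n + m * N) = h ^+ m * E n.
Proof.
elim: m => [|m IHm]; first by rewrite addn0 mul1g.
have -> : (n + m.+1 * N = N + (n + m * N))%N by rewrite mulSn addnCA.
rewrite expgS -mulgA -IHm [LHS](@big_cat_nat _ _ _ N) //= ?leq_addr //; congr (_ * _).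
rewrite -{1}(add0n N) big_addn addnC addnK; apply: eq_bigr => i _.
by rewrite /c modnDr.
Qed.

(** For vertices of the same type, the word between the two prefixes, deprived of
    its first letter, starts on the side opposite to that of this letter, so the
    prefixes differ by an element outside the side of this letter. *)
Lemma prefix_vertex_neq m n : (m < n)%N ->
  cosetv S (~~ odd m) (E m) <> cosetv S (~~ odd n) (E n).
Proof.
move=> mn e; have et : ~~ odd m = ~~ odd n := congr1 (@vtype _ S) e.
have mn' : (m.+1 < n)%N.
  rewrite ltn_neqAle mn andbT; apply: contra_eqN et => /eqP <- /=.
  by case: (odd m).
rewrite -et in e; move/cosetvP: e; rewrite prefix_cat ?(ltnW mn) // big_ltn //.
have [Xc _] := letter_side m => /(sideMl _ Xc) /starts_side/(_ (segment_starts mn')).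
by rewrite /=; case: (odd m).
Qed.

(* The exponent [`|i|%N] only has to make the index non-negative. *)
Let e (i : int) := h ^- `|i|%N * E `|(i + (`|i|%N * N)%N%:Z)%R|%N.

Lemma edgeE m n (i : int) : (n%:Z = i + (m * N)%N%:Z)%R -> e i = h ^- m * E n.
Proof.
have shift k m' n' : h ^- (m' + k) * E (n' + k * N) = h ^- m' * E n'.
  by rewrite prefix_period addnC expgnDr invgM -mulgA mulKg.
move=> en; rewrite /e; set m0 := `|i|%N; set n0 := absz _.
have en0 : (n0%:Z = i + (m0 * N)%N%:Z)%R by rewrite /n0 /m0 /N; nia.
have [mm0|/ltnW mm0] := leqP m m0.
  have -> : n0 = (n + (m0 - m) * N)%N by nia.
  by have := shift (m0 - m)%N m n; rewrite subnKC.
have -> : n = (n0 + (m - m0) * N)%N by nia.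
by have := shift (m - m0)%N m0 n0; rewrite subnKC.
Qed.

Lemma edge_nat (n : nat) : e n = E n.
Proof. by rewrite (@edgeE 0 n) ?invg1 ?mul1g // mul0n GRing.addr0. Qed.

Definition spelled_line (i : int) : coset_tree S := cosetv S (~~ odd `|i|%N) (e i).

Lemma edge_common (i j : int) : exists m ni nj,
  [/\ e i = h ^- m * E ni, odd ni = odd `|i|%N,
      e j = h ^- m * E nj, odd nj = odd `|j|%N & (nj%:Z - ni%:Z = j - i)%R].
Proof.
pose m := (`|i|%N + `|j|%N)%N.
have [ni eni] : exists n : nat, (n%:Z = i + (m * N)%N%:Z)%R.
  by exists `|(i + (m * N)%N%:Z)%R|%N; rewrite /m /N; nia.
have [nj enj] : exists n : nat, (n%:Z = j + (m * N)%N%:Z)%R.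
  by exists `|(j + (m * N)%N%:Z)%R|%N; rewrite /m /N; nia.
have par (k : int) n : (n%:Z = k + (m * N)%N%:Z)%R -> odd n = odd `|k|%N.
  have := odd_period n m; have := odd_period `|k|%N m; have : ~~ odd (m * N).
    by rewrite oddM (negbTE even_s) andbF.
  by lia.
exists m, ni, nj; split; [exact: edgeE|exact: par|exact: edgeE|exact: par|lia].
Qed.

Lemma cosetv_mul t g x y :
  cosetv S t x = cosetv S t y <-> cosetv S t (g * x) = cosetv S t (g * y).
Proof. by rewrite !cosetvP invgM -mulgA mulKg. Qed.

Lemma spelled_is_line : is_line spelled_line.
Proof.
split=> [i j|i].
  have neq (k l : int) : (k < l)%R -> spelled_line k <> spelled_line l.
    have [m [nk [nl [ek ok el ol d]]]] := edge_common k l => kl eq.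
    have nkl : (nk < nl)%N by lia.
    have et : ~~ odd nk = ~~ odd nl by rewrite ok ol; exact: (congr1 (@vtype _ S) eq).
    apply: (prefix_vertex_neq nkl); rewrite -et; apply/(cosetv_mul _ (h ^- m)).
    by rewrite -ek -el {2}et ok ol; exact: eq.
  by case: (Order.TotalTheory.ltgtP i j) => // [/neq|/neq + /esym].
have [m [ni [nj [ei oi ej oj d]]]] := edge_common i (i + 1)%R.
have nj1 : nj = ni.+1 by lia.
apply/coset_adjP; exists (~~ odd `|i|%N), (e (i + 1)%R); split.
  apply/cosetvP; rewrite ei ej invgM -mulgA mulKg prefix_cat nj1 // big_nat1 -oi.
  by case: (letter_side ni).
by rewrite /spelled_line -oj -oi nj1 negbK.
Qed.

Lemma spelled_translate (i : int) :
  spelled_line (i + N%:Z)%R = cosetv S (~~ odd `|i|%N) (h * e i).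
Proof.
have [m [ni [nj [ei oi ej oj d]]]] := edge_common i (i + N%:Z)%R.
have en : nj = (ni + 1 * N)%N by lia.
rewrite /spelled_line -oj en odd_period -oi ei ej en prefix_period expg1; congr cosetv.
by rewrite !mulgA; congr (_ * _); rewrite -expVgn; exact/commute_sym/commuteX/commuteV.
Qed.

Lemma spelled_start : spelled_line (- 1)%R = cosetv S false 1.
Proof.
apply/cosetvP; rewrite mulg1.
have -> : e (-1)%R = h ^- 1 * E N.-1 by apply: edgeE; rewrite mul1n; lia.
have eN : N = N.-1.+1 by rewrite prednK.
have -> : (h ^- 1 * E N.-1)^-1 = (E N.-1)^-1 * E N by rewrite invgM invgK.
rewrite prefix_cat ?leq_pred // [X in \prod_(_ <= i < X) _]eN big_nat1.
have [+ _] := letter_side N.-1.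
by have -> : odd N.-1 by move: even_s; rewrite -/N eN /= negbK.
Qed.

Lemma spelled_end : spelled_line (N : nat) = cosetv S true (\prod_(x <- s) x).
Proof.
rewrite /spelled_line edge_nat /= even_s; congr cosetv; rewrite (big_nth 1).
by rewrite /E; apply: eq_big_nat => i /andP[_ iN]; rewrite /c modn_small.
Qed.

End Line.
End Words.

(** * The action on the tree *)

Section TreeAction.
Variables (F Q : groupType) (S : free_splitting F).
Variable j : Q -> automorphism F.
Hypothesis jM : {morph j : p q / p * q}.
Hypothesis adaptedQ : forall q, exists k, adapted S (j q) k.
Notation X := (side S).

Lemma j1 : j 1 = 1.
Proof. by apply: (mulgI (j 1)); rewrite -jM !mulg1. Qed.

Definition twist q : F := sval (cid (adaptedQ q)).

Lemma twistP q : adapted S (j q) (twist q).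
Proof. exact: svalP (cid (adaptedQ q)). Qed.

Lemma twist1 : twist 1 = 1.
Proof.
by apply: adapted_uniq (@twistP 1) _; rewrite j1; exact: adapted1.
Qed.

Lemma twistM p q : twist (p * q) = j p (twist q) * twist p.
Proof.
apply: adapted_uniq (@twistP _) _; rewrite jM.
by apply: adaptedM; exact: twistP.
Qed.

(** If [f] maps [side t] to its conjugate by [k^-1] then it maps the coset [g * side t]
    to [f g * k * side t * k^-1]; right multiplication by [k] gives a coset again. *)
Definition coset_act (q : Q) (x : coset_tree S) : coset_tree S :=
  cosetv S (vtype x) (j q (sval (cid (cosetvW x))) * twist q).

Lemma coset_actE q t g : coset_act q (cosetv S t g) = cosetv S t (j q g * twist q).
Proof.
rewrite /coset_act; case: cid => h /= /cosetvP Xgh; apply/esym/cosetvP.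
have -> : (j q g * twist q)^-1 * (j q h * twist q) = j q (g^-1 * h) ^ twist q.
  by rewrite aut_morph aut_V conjgE invgM !mulgA.
exact: (proj1 (@twistP q t _)).
Qed.

Fact coset_act1 x : coset_act 1 x = x.
Proof.
have [g ->] := cosetvW x; rewrite coset_actE twist1 mulg1.
by rewrite j1.
Qed.

Fact coset_actM p q x : coset_act (p * q) x = coset_act p (coset_act q x).
Proof.
have [g ->] := cosetvW x; rewrite !coset_actE twistM aut_morph mulgA.
by rewrite jM.
Qed.

Fact coset_act_adj q : {mono coset_act q : x y / adj x y}.
Proof.
have homo p x y : adj x y -> adj (coset_act p x) (coset_act p y).
  case/coset_adjP => t [g [-> ->]]; rewrite !coset_actE.
  by apply/coset_adjP; exists t, (j p g * twist p).
move=> x y; apply/idP/idP; last exact: homo.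
by move/(homo q^-1); rewrite -!coset_actM mulVg !coset_act1.
Qed.

Definition tree_action : graph_action Q (coset_tree S) :=
  GraphAction coset_act1 coset_actM coset_act_adj.

Hypothesis innerQ : forall c, exists q, forall x, j q x = c * x * c^-1.

Lemma inner_act c q : (forall y, j q y = c * y * c^-1) ->
  forall t g, tree_action q (cosetv S t g) = cosetv S t (c * g).
Proof.
move=> qc t g; rewrite /= coset_actE; suff -> : twist q = c by rewrite qc mulgVK.
apply: adapted_uniq (@twistP q) _ => t' y.
by rewrite qc conjgE mulgVK mulKg.
Qed.

Lemma tree_action_free : fixed_point_free tree_action.
Proof.
have no_fix x : ~ fixes_vertex tree_action x.
  move=> fx; have [g ex] := cosetvW x; set t := vtype x in ex.
  have XT c : X t c.
    have [q qc] := innerQ (g * c * g^-1); have := fx q.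
    rewrite ex (inner_act qc) => /esym/cosetvP.
    by rewrite mulgVK mulKg.
  have [y Xy y1] := side_neq1 S (~~ t).
  have := side_starts (XT y) y1; move/(starts_side Xy).
  by case: (t).
split=> [[x /no_fix]//|[x [y [/coset_adjP[t [g [ex ey]]] fxy]]]].
apply: (no_fix x) => q; case: (fxy q) => [[]//|[]].
rewrite ex ey /= coset_actE => /(congr1 (@vtype _ S)) /=.
by case: (t).
Qed.

(** The line spelled by a word containing all the letters of [l] is translated by
    the inner automorphism of that word. An element fixing two vertices one
    period apart fixes every letter of the word, by rigidity of normal forms; in
    particular it fixes [l] pointwise, so it is trivial. *)
Lemma tree_action_WPD (l : seq F) :
    (forall x, x \in l -> exists t, X t x) ->
    (forall q, (forall x, x \in l -> j q x = x) -> q = 1) ->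
  exists g, WPD tree_action g.
Proof.
move=> Xl lQ; have [s [alt even_s s_gt0 sl]] := alternating_cover Xl.
have [q qh] := innerQ (\prod_(0 <= i < size s) nth 1 s (i %% size s)).
exists q; set L := spelled_line S s.
have axisL : is_axis tree_action q L.
  split; first exact: spelled_is_line.
  exists (size s) => // i; rewrite /L spelled_translate //.
  exact: (inner_act qh).
split; first by exists L.
exists L; split=> //; exists (- 1)%R, (size s : int).
apply: (@sub_finite_set _ _ [set 1]) => [p []|]; last exact: finite_set1.
rewrite /stab /= /L spelled_start // spelled_end // !coset_actE aut_1 mul1g.
move=> /cosetvP; rewrite mulg1 => /sideV; rewrite invgK => Xk /cosetvP Xy.
set k := twist p in Xk Xy; apply: lQ.
rewrite -(prod_big true) in Xy; set w := eval _ _ _ in Xy.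
pose s' := [seq j p x ^ k | x <- s].
have alt' t r : alternating S t r -> alternating S t [seq j p x ^ k | x <- r].
  elim: r t => //= x r IHr t [Xx x1 /IHr altr].
  by have [] := adapted_letter (@twistP p) Xx x1; split.
have prod' t r : eval (fun=> id) t [seq j p x ^ k | x <- r] =
    j p (eval (fun=> id) t r) ^ k.
  by elim: r t => [|x r IHr] t /=; rewrite ?aut_1 ?conj1g // IHr aut_morph conjMg.
have [||||k1 e] :=
  @alternating_rigid _ S true s s' k ((j p w * k)^-1 * w) _ alt (alt' _ _ alt).
- by rewrite size_map.
- exact: Xk.
- by rewrite (negbTE even_s).
- by rewrite prod' -/w conjgE mulgA !mulVKg.
move=> x xl; have [->|x1] := eqVneq x 1; first exact: aut_1.
have := nth_index 1 (sl x xl x1); set i := index x s => ei.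
have is_ : (i < size s)%N by rewrite index_mem; exact: sl.
by have := congr1 (nth 1 ^~ i) e; rewrite (nth_map 1) // ei k1 conjg1.
Qed.

End TreeAction.

(** * Actions of free products and quotients on sets *)

Record set_action (G : groupType) (W : Type) := SetAction {
  sact :> G -> W -> W;
  sact1 : forall w, sact 1 w = w;
  sactM : forall x y w, sact (x * y) w = sact x (sact y w) }.

Section FreeAction.
Variables (V : choiceType) (G : V -> groupType) (W : Type).
Variable a : forall v, set_action (G v) W.

Definition word_act (s : word G) (w : W) : W :=
  foldr (fun x w => a (tag x) (tagged x) w) w s.

Lemma word_act_eq s t : word_eq s t -> word_act s =1 word_act t.
Proof.
elim=> {s t} [//|s t _ IH w|s t r _ IHst _ IHtr w|s t v w|s t v g h w].
- by rewrite IH.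
- by rewrite IHst.
- by rewrite /word_act !foldr_cat /= sact1.
- by rewrite /word_act !foldr_cat /= sactM.
Qed.

Definition free_sact (x : free_product G) : W -> W :=
  word_act (repr (x : {eq_quot word_equiv G})).

Lemma free_sactE s w : free_sact (to_free s) w = word_act s w.
Proof. by apply: word_act_eq; apply/to_freeP; exact: reprK. Qed.

Fact free_sact1 w : free_sact 1 w = w.
Proof. exact: (free_sactE [::]). Qed.

Fact free_sactM x y w : free_sact (x * y) w = free_sact x (free_sact y w).
Proof.
elim/freeW: x => s; elim/freeW: y => t.
have -> : to_free s * to_free t = to_free (s ++ t) by exact: free_mulE.
by rewrite !free_sactE /word_act foldr_cat.
Qed.

Definition free_action : set_action (free_product G) W :=
  SetAction free_sact1 free_sactM.

Lemma free_action_inj v (g : G v) w : free_action (free_inj g) w = a v g w.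
Proof. exact: free_sactE. Qed.

End FreeAction.

Section QuotientAction.
Variables (G : groupType) (W : Type) (a : set_action G W) (R : set G).
Hypothesis Ra : forall x, R x -> forall w, a x w = w.

Lemma normal_closure_act x : normal_closure R x -> forall w, a x w = w.
Proof.
have aK y : (forall w, a y w = w) -> forall w, a y^-1 w = w.
  by move=> ay w; rewrite -{1}(ay w) -sactM mulVg sact1.
move=> Nx; apply/asboolP.
apply: (Nx [pred x | `[< forall w, a x w = w >]]).
- split=> [|y z /asboolP ay /asboolP az]; apply/asboolP => w; first exact: sact1.
  by rewrite sactM aK.
- move=> h g /asboolP ah; apply/asboolP => w.
  by rewrite conjgE !sactM ah -sactM mulVg sact1.
- by move=> y /set_mem Ry; apply/asboolP; exact: Ra.
Qed.

Definition quot_sact (x : quot_group R) : W -> W :=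
  a (repr (x : {eq_quot nc_equiv R})).

Lemma quot_sactE x w : quot_sact (to_quot R x) w = a x w.
Proof.
rewrite /quot_sact; set r := repr _.
have /to_quotP N : to_quot R r = to_quot R x by exact: to_quot_repr.
by rewrite -[x in RHS](mulVKg r) sactM (normal_closure_act N).
Qed.

Fact quot_sact1 w : quot_sact 1 w = w.
Proof. by rewrite (quot_sactE 1) sact1. Qed.

Fact quot_sactM x y w : quot_sact (x * y) w = quot_sact x (quot_sact y w).
Proof.
elim/quotW: x => x; elim/quotW: y => y.
by rewrite -to_quotM !quot_sactE sactM.
Qed.

Definition quot_action : set_action (quot_group R) W :=
  SetAction quot_sact1 quot_sactM.

End QuotientAction.

(** * Reduced words *)

Section ReducedWords.
Variables (V : choiceType) (G : V -> groupType).

Definition head_tag v (s : word G) : bool :=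
  if s is x :: _ then tag x == v else false.

Fixpoint reduced (s : word G) : bool :=
  if s is x :: s' then [&& tagged x != 1, ~~ head_tag (tag x) s' & reduced s']
  else true.

Definition reduced_word : Type := {s : word G | reduced s}.

(** A reduced word is recovered from its first letter in [G v], taken to be [1] if
    there is none, and the rest. *)
Definition hd v (s : word G) : G v := 
  if s is x :: _ then @untag V (fun w => G w) (G v) 1 v id x else 1.

Definition tl v (s : word G) : word G :=
  if s is x :: s' then if tag x == v then s' else s else [::].

Definition join v (g : G v) (s : word G) : word G :=
  if g == 1 then s else letter g :: s.

Lemma hd_letter v (g : G v) s : hd v (letter g :: s) = g.
Proof. by rewrite /hd (untagE _ _ (erefl : tag (letter g) = v)). Qed.

Lemma hd_other v s : ~~ head_tag v s -> hd v s = 1.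
Proof. by case: s => //= x s; exact: untag_dflt. Qed.

Lemma tl_other v s : ~~ head_tag v s -> tl v s = s.
Proof. by case: s => //= x s /negbTE ->. Qed.

Lemma join_hd_tl v s : reduced s -> join (hd v s) (tl v s) = s.
Proof.
have [|nv] := boolP (head_tag v s); last by rewrite hd_other // tl_other // /join eqxx.
case: s => // -[w g] s /eqP /= e; subst w => /andP[g1 _].
rewrite -/(letter g) -[untag _ _ _]/(hd v (letter g :: s)) hd_letter eqxx.
by rewrite /join (negbTE g1).
Qed.

Lemma hd_join v (g : G v) s : ~~ head_tag v s -> hd v (join g s) = g.
Proof.
move=> nv; rewrite /join; case: eqP => [->|_]; first exact: hd_other.
exact: hd_letter.
Qed.

Lemma tl_join v (g : G v) s : ~~ head_tag v s -> tl v (join g s) = s.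
Proof.
by move=> nv; rewrite /join; case: eqP => _; [exact: tl_other|rewrite /= eqxx].
Qed.

Lemma tl_reduced v s : reduced s -> reduced (tl v s) && ~~ head_tag v (tl v s).
Proof.
case: s => [//|x s] /= /and3P[x1 nx rs].
by have [<-|ne] := eqVneq (tag x) v; rewrite /= ?x1 ?nx rs.
Qed.

Lemma join_reduced v (g : G v) s : reduced s -> ~~ head_tag v s -> reduced (join g s).
Proof. by move=> rs nv; rewrite /join; case: ifPn => //= ->; rewrite nv. Qed.

Fact mul_word_subproof v (g : G v) (s : reduced_word) :
  reduced (join (g * hd v (val s)) (tl v (val s))).
Proof. by have /andP[rs nv] := tl_reduced v (valP s); exact: (join_reduced _ rs nv). Qed.

Definition mul_word v (g : G v) (s : reduced_word) : reduced_word :=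
  @exist (word G) reduced _ (mul_word_subproof g s).

Fact mul_word1 v s : mul_word (1 : G v) s = s.
Proof. by apply: val_inj; rewrite /= mul1g join_hd_tl //; exact: (valP s). Qed.

Fact mul_wordM v (g h : G v) s : mul_word (g * h) s = mul_word g (mul_word h s).
Proof.
have /andP[_ nv] := tl_reduced v (valP s).
by apply: val_inj; rewrite /= hd_join // tl_join // mulgA.
Qed.

Definition mul_action v : set_action (G v) reduced_word :=
  SetAction (@mul_word1 v) (@mul_wordM v).

Definition trivial_action (H : groupType) (W : Type) : set_action H W :=
  @SetAction H W (fun _ w => w) (fun=> erefl) (fun _ _ _ => erefl).

Definition empty_word : reduced_word := @exist (word G) reduced [::] isT.

Lemma head_tag_mul v (g : G v) (s : reduced_word) : g != 1 ->
  ~~ head_tag v (val s) -> head_tag v (val (mul_word g s)).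
Proof.
move=> g1 nv; rewrite /= hd_other // mulg1 tl_other // /join (negbTE g1).
by rewrite /= eqxx.
Qed.

End ReducedWords.

(** * The free product of two non-adjacent vertex-groups *)

Section TwoFactors.
Variables (Gam : sgraph) (G : Gam -> groupType).
Variables (u v : Gam).
Hypotheses (uv : u != v) (nadj : ~~ adj u v).
Hypothesis ntG : forall w, nontrivial (G w).

Definition other_factors : set (graph_product G) :=
  [set x | exists w, [/\ w != u, w != v & @Defs.factor Gam G w x]].

Definition free_quotient : groupType := quot_group other_factors.

Definition retract (x : graph_product G) : free_quotient := to_quot other_factors x.

Lemma retractM x y : retract (x * y) = retract x * retract y.
Proof. exact: to_quotM. Qed.

Definition chosen t : Gam := if t then u else v.

Definition vertex_side t : set free_quotient := retract @` @Defs.factor Gam G (chosen t).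

(** [G u] and [G v] act on reduced words by multiplication and the other
    vertex-groups act trivially; since [u] and [v] are not adjacent, commutators
    over edges act trivially. *)
Definition vertex_action w : set_action (G w) (reduced_word G) :=
  if (w == u) || (w == v) then mul_action G w else trivial_action _ _.

Lemma edge_commutators_act x : @edge_commutators Gam G x ->
  forall s, free_action vertex_action x s = s.
Proof.
case=> w [w' [g [h [adjw ->]]]] s.
have act_trivial z (k : G z) : (z == u) || (z == v) = false ->
    forall s', free_action vertex_action (free_inj k) s' = s'.
  by move=> zuv s'; rewrite free_action_inj /vertex_action zuv.
have actV x' : (forall s', free_action vertex_action x' s' = s') ->
    forall s', free_action vertex_action x'^-1 s' = s'.
  by move=> ax s'; rewrite -{1}(ax s') -sactM mulVg sact1.
have [wuv|/negbTE wuv] := boolP ((w == u) || (w == v)).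
  have w'uv : (w' == u) || (w' == v) = false.
    apply: contraTF adjw => /orP[]/eqP -> ; case/orP: wuv => /eqP ->.
    - by rewrite adj_irr.
    - by rewrite adj_sym.
    - by [].
    - by rewrite adj_irr.
  have ah := act_trivial _ h w'uv.
  by rewrite commgEl conjgE !sactM ah (actV _ ah) -sactM mulVg sact1.
have ag := act_trivial _ g wuv.
by rewrite commgEl conjgE !sactM ag (actV _ ag) -sactM mulVg sact1.
Qed.

Definition product_action : set_action (graph_product G) (reduced_word G) :=
  quot_action edge_commutators_act.

Lemma product_action_inj w (g : G w) s :
  product_action (vertex_inj g) s = vertex_action w g s.
Proof.
rewrite -[LHS]/(quot_sact _ _ _).
by rewrite (quot_sactE edge_commutators_act); exact: free_action_inj.
Qed.

Lemma other_factors_act x : other_factors x -> forall s, product_action x s = s.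
Proof.
case=> w [wu wv [g _ <-]] s.
by rewrite product_action_inj /vertex_action (negbTE wu) (negbTE wv).
Qed.

Definition retract_action : set_action free_quotient (reduced_word G) :=
  quot_action other_factors_act.

Lemma retract_action_inj t (g : G (chosen t)) s :
  retract_action (retract (vertex_inj g)) s = mul_word g s.
Proof.
rewrite -[LHS]/(quot_sact _ _ _).
rewrite (quot_sactE other_factors_act) product_action_inj /vertex_action.
by case: t g => g; rewrite eqxx ?orbT.
Qed.

(** Letting an element act on the empty word gives its normal form. *)
Definition vertex_starts t : set free_quotient :=
  [set x | head_tag (chosen t) (val (retract_action x (empty_word G)))].

Lemma vertex_injM w (g h : G w) : vertex_inj (g * h) = vertex_inj g * vertex_inj h.
Proof.
rewrite /vertex_inj -to_quotM; congr to_quot; exact: free_injM.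
Qed.

Lemma vertex_inj1 w : vertex_inj (1 : G w) = 1.
Proof. by apply: (mulgI (vertex_inj (1 : G w))); rewrite -vertex_injM !mulg1. Qed.

Lemma factor_subgroup w : subgroup_set (@Defs.factor Gam G w).
Proof.
split=> [|_ _ [g _ <-] [h _ <-]]; first by exists 1 => //; exact: vertex_inj1.
exists (g / h) => //; rewrite vertex_injM; congr (_ * _).
by apply: (mulgI (vertex_inj h)); rewrite -vertex_injM !mulgV vertex_inj1.
Qed.

Lemma retract1 : retract 1 = 1.
Proof. by []. Qed.

Lemma retractV x : retract x^-1 = (retract x)^-1.
Proof. by apply: (mulgI (retract x)); rewrite -retractM !mulgV. Qed.

Lemma vertex_side_subgroup t : subgroup_set (vertex_side t).
Proof.
have [H1 HF] := factor_subgroup (chosen t).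
split=> [|_ _ [x Hx <-] [y Hy <-]]; first by exists 1.
by exists (x / y); [exact: HF|rewrite retractM retractV].
Qed.

Lemma factors_generate : generates [set x | exists w, @Defs.factor Gam G w x].
Proof.
move=> H [H1 HF] sH; elim/quotW => x; elim/freeW: x => s.
have HM x y : H x -> H y -> H (x * y).
  by move=> Hx Hy; rewrite -[y]invgK -[y^-1]mul1g; apply: (HF) => //; exact: HF.
elim: s => [|[w g] s IHs]; first exact: H1.
suff e : to_quot (@edge_commutators Gam G) (to_free (letter g :: s)) =
    vertex_inj g * to_quot (@edge_commutators Gam G) (to_free s).
  suff : H (vertex_inj g * to_quot (@edge_commutators Gam G) (to_free s)) by rewrite -e.
  by apply: HM => //; apply: sH; exists w, g.
rewrite -[RHS](to_quotM (@edge_commutators Gam G)); congr to_quot.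
by apply/esym; exact: (free_mulE [:: letter g]).
Qed.

Lemma retract_other w x : w != u -> w != v -> @Defs.factor Gam G w x -> retract x = 1.
Proof.
move=> wu wv wx; apply/esym/to_quotP; rewrite invg1 mul1g => H gH nH sH.
by apply: sH; apply/mem_set; exists w.
Qed.

Lemma retract_surj y : exists x, y = retract x.
Proof. by elim/quotW: y => x; exists x. Qed.

Lemma vertex_side_generate : generates [set x | exists t, vertex_side t x].
Proof.
move=> H [H1 HF] sH y; have [x ->] := retract_surj y.
apply: (factors_generate (H := [set x | H (retract x)])) => {x y} [|x [w wx]].
  split=> [|x y Hx Hy] /=; first exact: H1.
  by rewrite retractM retractV; exact: HF.
have [wu|wu] := eqVneq w u; first by apply: sH; exists true, x; rewrite //= -wu.
have [wv|wv] := eqVneq w v; first by apply: sH; exists false, x; rewrite //= -wv.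
by rewrite /= (retract_other wu wv wx).
Qed.

Lemma vertex_starts1 t : ~ vertex_starts t 1.
Proof. by rewrite /vertex_starts /mkset (sact1 retract_action). Qed.

Lemma vertex_starts_disjoint t x : vertex_starts t x -> ~ vertex_starts (~~ t) x.
Proof.
rewrite /vertex_starts /mkset; case: (val _) => //= z _ /eqP e /eqP.
by rewrite e => /eqP; case: (t); rewrite /= ?(negbTE uv) // eq_sym (negbTE uv).
Qed.

Lemma vertex_starts_mul t x y : vertex_side t x -> x != 1 -> ~ vertex_starts t y ->
  vertex_starts t (x * y).
Proof.
case=> _ [g _ <-] <- g1 /negP ny; rewrite /vertex_starts /mkset (sactM retract_action).
rewrite retract_action_inj; apply: head_tag_mul => //.
by apply: contraNneq g1 => ->; rewrite vertex_inj1 retract1.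
Qed.

Lemma vertex_side_neq1 t : exists2 x, vertex_side t x & x != 1.
Proof.
have [g g1] := ntG (chosen t); exists (retract (vertex_inj g)).
  by exists (vertex_inj g) => //; exists g.
apply/eqP => e; have := @head_tag_mul _ _ _ g (empty_word G) g1 isT.
by rewrite -retract_action_inj e (sact1 retract_action).
Qed.

Definition two_factor_splitting : free_splitting free_quotient :=
  FreeSplitting vertex_side_subgroup vertex_side_neq1 vertex_side_generate
    vertex_starts1 vertex_starts_disjoint vertex_starts_mul.

End TwoFactors.

(** * Descending automorphisms to a quotient *)

Section Descent.
Variables (G : groupType) (R : set G).

Definition descends (f : automorphism G) :=
  forall x, R x -> normal_closure R (f x).

Lemma descends_closure f x : descends f -> normal_closure R x -> normal_closure R (f x).
Proof.
move=> fR Nx; apply/asboolP.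
apply: (Nx [pred x | `[< normal_closure R (f x) >]]).
- split=> [|y z /asboolP Ny /asboolP Nz]; apply/asboolP.
    by rewrite aut_1; exact: normal_closure1.
  by rewrite aut_morph aut_V; exact: normal_closureF.
- by move=> h g /asboolP Nh; apply/asboolP; rewrite aut_J; exact: normal_closureJ.
- by move=> y /set_mem Ry; apply/asboolP; exact: fR.
Qed.

Definition quot_fun (f : automorphism G) (x : quot_group R) : quot_group R :=
  to_quot R (f (repr (x : {eq_quot nc_equiv R}))).

Lemma quot_funE f x : descends f -> quot_fun f (to_quot R x) = to_quot R (f x).
Proof.
move=> fR; rewrite /quot_fun; set r := repr _; apply/to_quotP.
rewrite -aut_V -aut_morph; apply: descends_closure => //.
by apply/to_quotP; exact: to_quot_repr.
Qed.

Variable f : automorphism G.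
Hypotheses (fR : descends f) (fVR : descends (aut_inv f)).

Fact quot_fun_morph : {morph quot_fun f : x y / x * y}.
Proof.
elim/quotW => x; elim/quotW => y.
by rewrite -to_quotM !quot_funE // aut_morph to_quotM.
Qed.

Fact quot_fun_bij : bijective (quot_fun f).
Proof.
exists (quot_fun (aut_inv f)); elim/quotW => x; rewrite -/(to_quot R x).
  by rewrite !quot_funE // aut_funK.
by rewrite !quot_funE // aut_invK.
Qed.

Definition quot_aut : automorphism (quot_group R) :=
  Automorphism quot_fun_morph quot_fun_bij.

End Descent.

Section Image.
Variables (G H : groupType) (f : {multiplicative G -> H}).

Definition in_image : pred H := fun y => `[< exists x, f x = y >].

Fact in_image_group_closed : group_closed in_image.
Proof.
have f1 : f 1 = 1 by apply: (mulgI (f 1)); rewrite -gmulfM !mulg1.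
split=> [|_ _ /asboolP[x <-] /asboolP[y <-]]; apply/asboolP; first by exists 1.
exists (x / y); rewrite gmulfM; congr (_ * _).
by apply: (mulgI (f y)); rewrite -gmulfM !mulgV.
Qed.

Definition image_group : Type := {y : H | in_image y}.
HB.instance Definition _ := SubChoice.on image_group.
HB.instance Definition _ :=
  SubChoice_isSubGroup.Build _ _ image_group in_image_group_closed.

Fact to_image_subproof x : in_image (f x).
Proof. by apply/asboolP; exists x. Qed.

Definition to_image (x : G) : image_group := @exist H in_image _ (to_image_subproof x).

Fact to_imageM : {morph to_image : x y / x * y}.
Proof. by move=> x y; apply: val_inj; rewrite valM /= gmulfM. Qed.

HB.instance Definition _ := isMultiplicative.Build G image_group to_image to_imageM.

Lemma to_image_surj (q : image_group) : exists x, to_image x = q.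
Proof.
by case: q => y yf; have /asboolP[x e] := yf; exists x; apply: val_inj.
Qed.

End Image.

(** * The action of partially conjugating automorphisms on the free product *)

Section PConjFree.
Variables (Gam : sgraph) (G : Gam -> groupType) (u v : Gam).
Notation R := (@other_factors Gam G u v).
Notation F := (free_quotient G u v).
Notation ret := (@retract Gam G u v).

Lemma pconj_descends (p : PConjAut G) : descends R (val p).
Proof.
move=> x [w [wu wv wx]].
have /asboolP/(_ w)[g fw] := valP p.
have : (val p @` Defs.factor w) (val p x) by exists x.
rewrite fw => -[y wy <-]; apply: normal_closureJ => H gH nH sH.
by apply: sH; apply/mem_set; exists w.
Qed.

Lemma pconjV_descends (p : PConjAut G) : descends R (aut_inv (val p)).
Proof. exact: (pconj_descends p^-1). Qed.

Definition pconj_aut (p : PConjAut G) : automorphism F :=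
  quot_aut (@pconj_descends p) (@pconjV_descends p).

Lemma pconj_autE p x : pconj_aut p (ret x) = ret (val p x).
Proof. exact: (quot_funE _ (@pconj_descends p)). Qed.

Fact pconj_autM : {morph pconj_aut : p q / p * q}.
Proof.
move=> p q; apply: aut_ext => y; have [x ->] := retract_surj y.
by rewrite -[RHS]/(pconj_aut p (pconj_aut q (ret x))) !pconj_autE.
Qed.

HB.instance Definition _ :=
  isMultiplicative.Build (PConjAut G) (automorphism F) pconj_aut pconj_autM.

Lemma retractJ x y : ret (x ^ y) = ret x ^ ret y.
Proof. by rewrite conjgE !retractM retractV. Qed.

Lemma pconj_aut_side p : exists g, forall t,
  pconj_aut p @` @vertex_side Gam G u v t = [set x ^ g t | x in @vertex_side Gam G u v t].
Proof.
have /asboolP/choice[g fp] := valP p.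
exists (fun t => ret (g (chosen u v t))) => t; have fpg := fp (chosen u v t).
rewrite predeqE => y; split.
  case=> _ [x wx <-] <-; rewrite pconj_autE.
  have : (val p @` Defs.factor (chosen u v t)) (val p x) by exists x.
  rewrite fpg => -[z wz <-]; exists (ret z); first by exists z.
  by rewrite retractJ.
case=> _ [x wx <-] <-; rewrite -retractJ.
set w := chosen u v t in wx fpg *.
have : conjugate_set (Defs.factor w) (g w) (x ^ g w) by exists x.
rewrite -fpg => -[z wz <-]; exists (ret z); first by exists z.
exact: pconj_autE.
Qed.

Lemma pconj_aut_inner c : exists p, forall x, pconj_aut p x = c * x * c^-1.
Proof.
have [d ->] := retract_surj c.
pose f x := d * x * d^-1.
have fM : {morph f : x y / x * y} by move=> x y; rewrite /f !mulgA mulgVK.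
have fB : bijective f.
  exists (fun x => d^-1 * x * d) => x; rewrite /f !mulgA.
    by rewrite mulVg mul1g mulgVK.
  by rewrite mulgV mul1g mulgK.
have pf : is_pconj (Automorphism fM fB).
  apply/asboolP => w; exists d^-1; apply: eq_imagel => x _.
  by rewrite conjgE invgK mulgA.
exists (@exist (automorphism (graph_product G)) (@is_pconj Gam G) _ pf) => y.
have [x ->] := retract_surj y.
by rewrite pconj_autE /= /f !retractM retractV.
Qed.

(** The fixed points of an automorphism form a subgroup, so it suffices to fix
    finite generating sets of the two factors. *)
Lemma finite_determining_set : (forall w, finitely_generated (G w)) ->
  exists l : seq F, (forall x, x \in l -> exists t, @vertex_side Gam G u v t x) /\
    forall f : automorphism F, (forall x, x \in l -> f x = x) -> f = 1.
Proof.
move=> fgG; pose i t (g : G (chosen u v t)) : F := ret (vertex_inj g).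
have iM t (g h : G (chosen u v t)) : i t (g * h) = i t g * i t h.
  by rewrite /i vertex_injM retractM.
have i1 t : i t 1 = 1 by rewrite /i vertex_inj1.
have iV t (g : G (chosen u v t)) : i t g^-1 = (i t g)^-1.
  by apply: (mulgI (i t g)); rewrite -iM !mulgV.
have [s sG] := fgG (chosen u v true); have [s' s'G] := fgG (chosen u v false).
exists ([seq i true g | g <- s] ++ [seq i false g | g <- s']); split.
  move=> x; rewrite mem_cat => /orP[]/mapP[g _ ->].
    by exists true, (vertex_inj g) => //; exists g.
  by exists false, (vertex_inj g) => //; exists g.
move=> f fl; apply: aut_ext => x.
have fclosed t : group_closed [pred g : G (chosen u v t) | f (i t g) == i t g].
  split=> [|g h /eqP fg /eqP fh]; apply/eqP; first by rewrite i1 aut_1.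
  by rewrite iM iV aut_morph aut_V fg fh.
apply: (vertex_side_generate (H := [set x | f x = x])) => {x} [|x [t [_ [g _ <-] <-]]].
  split=> [|x y /= fx fy] /=; first exact: aut_1.
  by rewrite aut_morph aut_V fx fy.
apply/eqP; case: t g => g.
  apply: (sG _ (fclosed true)) => h hs; apply/eqP/fl.
  by rewrite mem_cat map_f.
apply: (s'G _ (fclosed false)) => h hs; apply/eqP/fl.
by rewrite mem_cat map_f // orbT.
Qed.

End PConjFree.

Theorem mainTheorem1 (Gam : sgraph) (G : Gam -> groupType) :
  (forall u, nontrivial (G u)) -> ~ complete_graph Gam ->
  exists (Q : groupType) (pi : {multiplicative PConjAut G -> Q})
         (T : sgraph) (a : graph_action Q T),
    [/\ (forall q : Q, exists f : PConjAut G, pi f = q),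
        is_tree T,
        fixed_point_free a
      & finite_set [set: Gam]%classic ->
        (forall u, finitely_generated (G u)) ->
        exists g : Q, WPD a g].
Proof.
move=> ntG /existsNP[u /existsNP[v /not_implyP[uv /negP nadj]]].
pose S := two_factor_splitting uv nadj ntG.
pose Q : groupType := image_group (@pconj_aut Gam G u v).
pose j (q : Q) : automorphism (free_quotient G u v) := val q.
have jM : {morph j : p q / p * q} by move=> p q; exact: valM.
have jpi p : j (to_image (@pconj_aut Gam G u v) p) = pconj_aut u v p by [].
have adaptedQ q : exists k, adapted S (j q) k.
  have [p <-] := to_image_surj q; have [g gP] := pconj_aut_side u v p.
  by rewrite jpi; apply: (@adapted_exists _ S _ g).
have innerQ c : exists q, forall x, j q x = c * x * c^-1.
  have [p pc] := pconj_aut_inner c.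
  by exists (to_image (@pconj_aut Gam G u v) p).
exists Q, (to_image (@pconj_aut Gam G u v)), (coset_tree S), (tree_action jM adaptedQ).
split.
- exact: to_image_surj.
- exact: coset_is_tree.
- exact: tree_action_free.
- move=> _ /(@finite_determining_set Gam G u v)[l [Xl lid]].
  apply: (tree_action_WPD jM adaptedQ innerQ Xl) => q ql.
  by apply: val_inj; exact: lid.
Qed.
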